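(* There exists a (randomized) streaming algorithm that, given $n$ coins arriving one by one in a stream in arbitrary order, with gap parameter $\Delta>0$ and confidence parameter $\delta\in(0,1)$, finds the most biased coin with probability at least $1-\delta$ using $O\!\left(\frac{n}{\Delta^2}\cdot\log(1/\delta)\right)$ coin tosses and a memory of a single coin.
   Context: Streaming coin tossing. There are $n$ coins $\mathrm{coin}_1,\dots,\mathrm{coin}_n$ with unknown biases $p_1,\dots,p_n\in[0,1]$; each toss of $\mathrm{coin}_i$ is an independent Bernoulli$(p_i)$ random variable. The gap parameter $\Delta$ is the difference between the largest bias and the second largest bias; it is assumed that $\Delta>0$ (so the most biased coin is unique) and that $\Delta$ and $\delta$ are known to the algorithm. The coins arrive one by one in a stream. At any time the algorithm may toss only the currently arriving coin or a coin explicitly stored in its memory; a coin that is not stored, or that is removed from memory, can no longer be tossed or recovered. The memory (space complexity) of the algorithm is the maximum number of coins it stores at any point during the stream (the coin currently arriving is not counted unless it is stored; auxiliary information such as counters is not counted). ''Finds the most biased coin'' means that at the end of the stream the algorithm outputs a coin, and this coin is the one with the largest bias. $O(\cdot)$ hides an absolute constant independent of $n,\Delta,\delta$ and the biases. *)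

(* Defs.v *)
(* MathComp, with the real numbers of MathComp-Analysis. *)
From mathcomp Require Import all_boot all_order all_algebra.
From mathcomp Require Import reals exp.

Set Implicit Arguments.
Unset Strict Implicit.
Unset Printing Implicit Defensive.

Import Order.TTheory GRing.Theory Num.Theory.
Local Open Scope ring_scope.

(** * Finite distributions *)

(* A finite list of (weight, value) pairs.  A value may occur several times:
   in the law of an algorithm below there is one entry per computation path.
   The weights of [dret], [dunif] and [dbern p] with 0 <= p <= 1 are nonnegative
   and sum to 1, and [dbind] preserves this. *)
Definition fdist (R : Type) (X : Type) : Type := seq (R * X).

Section FiniteDistributions.
Variable R : realType.

Definition dret (X : Type) (x : X) : fdist R X := [:: (1, x)].

Definition dbind (X Y : Type) (d : fdist R X) (f : X -> fdist R Y) : fdist R Y :=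
  flatten [seq [seq (wx.1 * wy.1, wy.2) | wy <- f wx.2] | wx <- d].

Definition dbern (p : R) : fdist R bool := [:: (p, true); (1 - p, false)].

Definition dunif (m : nat) : fdist R 'I_m.+1 :=
  [seq (m.+1%:R^-1, i) | i <- enum 'I_m.+1].

Definition Pr (X : Type) (d : fdist R X) (E : pred X) : R :=
  \sum_(wx <- d | E wx.2) wx.1.

(* [E] holds on every computation path, including paths of weight 0. *)
Definition always (X : Type) (d : fdist R X) (E : pred X) : bool :=
  all (fun wx => E wx.2) d.

End FiniteDistributions.

(** * Streaming algorithms *)

(* The only coins an algorithm can refer to: it has no access to the identity
   of a coin, to its bias, or to its position in the original numbering. *)
Inductive handle := Arriving | Slot of nat.

(* [Toss] passes the outcome of the toss to the continuation; [Draw m] is the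
   internal randomness, a uniform draw from {0, ..., m}; [Store] puts the
   arriving coin in a new slot, after the occupied ones; [Discard k] removes
   the coin in slot [k], the later slots being renumbered. *)
Inductive prog (A : Type) : Type :=
| Ret of A
| Toss of handle & (bool -> prog A)
| Draw (m : nat) of ('I_m.+1 -> prog A)
| Store of prog A
| Discard of nat & prog A.

(* [aux] is the type of the auxiliary information (counters etc.), which is
   not charged for.  [step] is executed on each arrival.  [finish] is executed
   once the stream has ended, when no coin is arriving any more; it returns the
   slot of the coin to output.  The length of the stream is not an input. *)
Record algorithm := Algorithm {
  aux : Type;
  init : aux;
  step : aux -> prog aux;
  finish : aux -> prog nat }.

Record config (C : Type) := Config {
  mem : seq C;     (* the stored coins *)
  ntoss : nat;     (* number of tosses made so far *)
  peak : nat }.    (* maximum of [size mem] so far *)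

Record outcome (C : Type) := Outcome {
  output : option C;
  tosses_used : nat;
  memory_used : nat }.

Section Semantics.
Variables (R : realType) (C : Type) (bias : C -> R).

Definition fetch (cur : option C) (c : config C) (h : handle) : option C :=
  match h with Arriving => cur | Slot k => onth (mem c) k end.

(* Tossing an empty slot carries no information: it always returns [false]. *)
Definition toss_law (oc : option C) : fdist R bool :=
  if oc is Some x then dbern (bias x) else dret R false.

Definition tossed (c : config C) : config C :=
  Config (mem c) (ntoss c).+1 (peak c).

Definition stored (cur : option C) (c : config C) : config C :=
  if cur is Some x then
    let m := rcons (mem c) x in Config m (ntoss c) (maxn (peak c) (size m))
  else c.

Definition discarded (k : nat) (c : config C) : config C :=
  Config (take k (mem c) ++ drop k.+1 (mem c)) (ntoss c) (peak c).

(* Each toss is a fresh Bernoulli draw, independent of the past.  [cur] is the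
   arriving coin; it is [None] after the end of the stream. *)
Fixpoint exec (A : Type) (pr : prog A) (cur : option C) (c : config C) :
    fdist R (config C * A) :=
  match pr with
  | Ret a => dret R (c, a)
  | Toss h k => dbind (toss_law (fetch cur c h))
                      (fun b => exec (k b) cur (tossed c))
  | Draw m k => dbind (dunif R m) (fun i => exec (k i) cur c)
  | Store k => exec k cur (stored cur c)
  | Discard i k => exec k cur (discarded i c)
  end.

Fixpoint exec_stream (alg : algorithm) (s : seq C) (c : config C) (x : aux alg) :
    fdist R (config C * aux alg) :=
  if s is coin :: s' then
    dbind (exec (step x) (Some coin) c)
          (fun cx => exec_stream s' cx.1 cx.2)
  else dret R (c, x).

Definition run (alg : algorithm) (s : seq C) : fdist R (outcome C) :=
  dbind (exec_stream s (Config [::] 0 0) (init alg)) (fun cx =>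
  dbind (exec (finish cx.2) None cx.1) (fun ck =>
  dret R (Outcome (onth (mem ck.1) ck.2) (ntoss ck.1) (peak ck.1)))).

End Semantics.

(** * Instances *)

Section Instances.
Variables (R : realType) (n : nat) (p : 'I_n -> R).

(* Largest minus second largest bias, counted with multiplicity; meaningful
   for n >= 2 only. *)
Definition gap : R :=
  let b := sort >=%R [seq p i | i <- enum 'I_n] in b`_0 - b`_1.

Definition most_biased (i : 'I_n) : bool := [forall j, p j <= p i].

Definition finds_most_biased (o : outcome 'I_n) : bool :=
  if output o is Some i then most_biased i else false.

End Instances.

(* Main.v *)
(* The stored coin (the king) is challenged by each new coin and receives a
   budget of [b] rounds per challenge, unused rounds being carried over.  In a
   round both coins are tossed; the king wins the challenge as soon as it leads
   by [h] heads, and is replaced by the challenger when its budget runs out.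
   With [theta = D / 4] and [lambda = D ^ 2 / 8], let [k] be the remaining budget
   and [d] the lead the king still needs.  If the king is the best coin, then
   [exp (theta d - lambda k)] is a supermartingale within a challenge and bounds
   the probability that the king is ever replaced, provided that
   [theta h <= lambda b]; this handles all later challenges at once, without a
   union bound.  If the challenger is the best coin, then [exp (- theta d)] bounds
   the probability that the king survives.  Hence [h] of order [ln (1/delta) / D]
   and [b] of order [ln (1/delta) / D ^ 2] suffice for [delta <= 1/2].  When
   [delta] is close to 1 the toss budget tends to 0; there the same procedure, at
   confidence 1/2, is run on a random residue class of arrival times, which
   contains the best coin with probability at least [2 (1 - delta)]. *)
Require Import Defs.
From mathcomp Require Import all_boot all_order all_algebra.
From mathcomp Require Import reals exp.
From mathcomp Require Import sequences.
From mathcomp Require Import ring lra zify.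

Set Implicit Arguments.
Unset Strict Implicit.
Unset Printing Implicit Defensive.

Import Order.TTheory GRing.Theory Num.Theory.
Local Open Scope ring_scope.

(** * Expectations and pathwise properties of finite distributions *)

Section Expectation.
Variable R : realType.

Definition Ex (X : Type) (d : fdist R X) (f : X -> R) : R :=
  \sum_(wx <- d) wx.1 * f wx.2.

Lemma Pr_Ex (X : Type) (d : fdist R X) (E : pred X) :
  Pr d E = Ex d (fun x => (E x)%:R).
Proof.
rewrite /Pr /Ex big_mkcond; apply: eq_bigr => wx _.
by case: (E _); rewrite ?mulr1 ?mulr0.
Qed.

Lemma Ex_dret (X : Type) (x : X) (f : X -> R) : Ex (dret R x) f = f x.
Proof. by rewrite /Ex big_seq1 mul1r. Qed.

Lemma Ex_dbind (X Y : Type) (d : fdist R X) (k : X -> fdist R Y) (f : Y -> R) :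
  Ex (dbind d k) f = Ex d (fun x => Ex (k x) f).
Proof.
rewrite /Ex /dbind big_flatten big_map; apply: eq_bigr => wx _.
by rewrite big_map big_distrr /=; apply: eq_bigr => wy _; rewrite mulrA.
Qed.

Lemma Ex_dbern (q : R) (f : bool -> R) :
  Ex (dbern q) f = q * f true + (1 - q) * f false.
Proof. by rewrite /Ex big_cons big_seq1. Qed.

Lemma Ex_dunif (m : nat) (f : 'I_m.+1 -> R) :
  Ex (dunif R m) f = m.+1%:R^-1 * \sum_i f i.
Proof. by rewrite /Ex big_map big_distrr /= big_enum. Qed.

Lemma eq_Ex (X : Type) (d : fdist R X) (f g : X -> R) :
  f =1 g -> Ex d f = Ex d g.
Proof. by move=> fg; apply: eq_bigr => wx _; rewrite fg. Qed.

Lemma always_dret (X : Type) (x : X) (E : pred X) : always (dret R x) E = E x.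
Proof. by rewrite /always /= andbT. Qed.

Lemma always_dbind (X Y : Type) (d : fdist R X) (k : X -> fdist R Y)
    (E : pred X) (F : pred Y) :
  always d E -> (forall x, E x -> always (k x) F) -> always (dbind d k) F.
Proof.
move=> + kF; rewrite /always /dbind.
elim: d => //= wx d IHd /andP[Ewx /IHd Fd]; rewrite all_cat Fd andbT all_map.
exact: kF.
Qed.

Lemma alwaysT (X : Type) (d : fdist R X) : always d predT.
Proof. exact: all_predT. Qed.

End Expectation.

(** * Exponential moment of one round *)

Section OneRound.
Variable R : realType.

(** From [exp (- y) >= 1 - y] at [y = x / 2], [exp x <= (1 - x / 2) ^ -2]; clearing the denominator
    leaves [1 - 3 x + x ^ 2 >= 0]. *)
Lemma expR_le_quad (x : R) : x <= 1/4 -> expR x <= 1 + x + x ^+ 2.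
Proof.
move=> x_le.
have z0 : 0 < 1 - x / 2 by lra.
have y0 := expR_gt0 (x / 2).
have yz : expR (x / 2) * (1 - x / 2) <= 1.
  have := expR_ge1Dx (- (x / 2)); rewrite expRN => le1.
  by rewrite mulrC -ler_pdivlMr // div1r.
have -> : expR x = expR (x / 2) ^+ 2.
  by rewrite expr2 -expRD; congr expR; field.
have w0 : 0 < (1 - x / 2) ^+ 2 by rewrite exprn_gt0.
rewrite -(ler_pM2r w0) -exprMn.
apply: (@le_trans _ _ 1); first by rewrite expr_le1 // mulr_ge0 // ltW.
have -> : (1 + x + x ^+ 2) * (1 - x / 2) ^+ 2
    = 1 + (x / 2) ^+ 2 * (1 - x * 3 + x ^+ 2) by field.
rewrite lerDl mulr_ge0 ?sqr_ge0 //.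
by have := sqr_ge0 x; lra.
Qed.

(* For biases [u + D <= v], the per-round difference of two tosses has
   exponential moment at most [exp (- theta D + 2 theta ^ 2)]; the choice
   [theta = D / 4] makes this [exp (- D ^ 2 / 8)]. *)
Lemma round_moment (u v D : R) :
  0 <= u -> v <= 1 -> 0 < D -> u + D <= v ->
  u * (v + (1 - v) * expR (D / 4)) + (1 - u) * (v * expR (- (D / 4)) + (1 - v))
  <= expR (- (D ^+ 2 / 8)).
Proof.
move=> u0 v1 D0 uv.
(* By independence the moment factors; the two sides differ by a multiple of
   [1 - exp theta * exp (- theta) = 0]. *)
have -> : u * (v + (1 - v) * expR (D / 4))
    + (1 - u) * (v * expR (- (D / 4)) + (1 - v))
  = (1 + u * (expR (D / 4) - 1)) * (1 + v * (expR (- (D / 4)) - 1)).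
  have := expRxMexpNx_1 (D / 4).
  move: (expR (D / 4)) (expR (- (D / 4))) => x y xy.
  transitivity ((1 + u * (x - 1)) * (1 + v * (y - 1)) + u * v * (1 - x * y)).
    by ring.
  by rewrite xy subrr mulr0 addr0.
have e1 : expR (D / 4) <= 1 + D / 4 + (D / 4) ^+ 2.
  by apply: expR_le_quad; lra.
have e2 : expR (- (D / 4)) <= 1 - D / 4 + (D / 4) ^+ 2.
  by rewrite -(sqrrN (D / 4)); apply: expR_le_quad; lra.
have p1 := expR_gt0 (D / 4); have p2 := expR_gt0 (- (D / 4)).
apply: (@le_trans _ _ (expR (u * (expR (D / 4) - 1)) *
                       expR (v * (expR (- (D / 4)) - 1)))).
  apply: ler_pM; rewrite ?expR_ge1Dx //; nra.
rewrite -expRD ler_expR.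
have : u * (expR (D / 4) - 1) <= u * (D / 4 + (D / 4) ^+ 2) by apply: ler_wpM2l => //; lra.
have : v * (expR (- (D / 4)) - 1) <= v * (- (D / 4) + (D / 4) ^+ 2).
  by apply: ler_wpM2l; lra.
nra.
Qed.

End OneRound.

(** * The algorithm and its pathwise resource bounds *)

Section Algorithm.
Variables m h b : nat.

(* [Some (r, k)]: [r] arrivals are to be ignored before the next challenge; [k]
   is the budget of the stored coin, if any. *)
Definition state : Type := option (nat * option nat).

(* [d] is the lead the stored coin still needs in order to win. *)
Fixpoint duel (budget d : nat) : prog state :=
  if d is d'.+1 then
    if budget is budget'.+1 then
      Toss (Slot 0) (fun x => Toss Arriving (fun y =>
        duel budget' (if x then if y then d else d' else if y then d.+1 else d)))
    else Discard 0 (Store (Ret (Some (m, Some 0%N))))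
  else Ret (Some (m, Some budget)).

Definition visit (rk : nat * option nat) : prog state :=
  match rk with
  | (r.+1, k) => Ret (Some (r, k))
  | (0%N, None) => Store (Ret (Some (m, Some 0%N)))
  | (0%N, Some budget) => duel (budget + b) h
  end.

Definition king_step (st : state) : prog state :=
  if st is Some rk then visit rk
  else Draw (fun r : 'I_m.+1 => visit (val r, None)).

Definition king_algorithm : algorithm :=
  Algorithm None king_step (fun _ => Ret 0%N).

Section Resources.
Variables (R : realType) (C : Type) (bias : C -> R).

Definition duel_inv (B : nat) (cs : config C * state) : bool :=
  if cs.2 is Some (r, Some budget) then
    [&& size (Defs.mem cs.1) == 1%N, (peak cs.1 <= 1)%N, r == m
      & (ntoss cs.1 + budget.*2 <= B)%N]
  else false.

Lemma duel_invP (y : C) (B budget d : nat) (c : config C) :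
  size (Defs.mem c) = 1%N -> (peak c <= 1)%N -> (ntoss c + budget.*2 <= B)%N ->
  always (exec bias (duel budget d) (Some y) c) (duel_inv B).
Proof.
elim: budget d c => [|budget IH] [|d] c sz pk nt;
  try by rewrite always_dret /duel_inv /= sz pk nt !eqxx.
  (* Budget exhausted: discarding precedes storing, so two coins are never held at once. *)
  rewrite always_dret /duel_inv /= eqxx addn0.
  case: (Defs.mem c) sz => [|x [|//]] //= _.
  by rewrite geq_max pk -(addn0 (ntoss c)) nt.
apply: (@always_dbind _ _ _ _ _ predT); first exact: alwaysT.
move=> x _; apply: (@always_dbind _ _ _ _ _ predT); first exact: alwaysT.
by move=> x' _; apply: IH => //=; move: nt; rewrite doubleS; lia.
Qed.

(* With [m.+1] arrivals between challenges and [2 b] tosses paid for by each,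
   [t + r] counts the arrivals up to the next challenge. *)
Definition stream_inv (t : nat) (cs : config C * state) : bool :=
  match cs.2 with
  | None => [&& nilp (Defs.mem cs.1), peak cs.1 == 0%N, ntoss cs.1 == 0%N & t == 0%N]
  | Some (r, None) => [&& nilp (Defs.mem cs.1), peak cs.1 == 0%N, ntoss cs.1 == 0%N
                        & (r <= m)%N]
  | Some (r, Some budget) => [&& size (Defs.mem cs.1) == 1%N, (peak cs.1 <= 1)%N,
      (r <= m)%N & (m.+1 * (ntoss cs.1 + budget.*2) + b.*2 * m.+1
                     <= b.*2 * (t + r))%N]
  end.

Lemma visit_inv (y : C) (t : nat) (rk : nat * option nat) (c : config C) :
  stream_inv t (c, Some rk) ->
  always (exec bias (visit rk) (Some y) c) (stream_inv t.+1).
Proof.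
case: rk => [[|r] [budget|]] /and4P[/= sz pk].
- move=> _ le_t.
  have [B le_B ntB] : exists2 B, (m.+1 * B <= b.*2 * t)%N
      & (ntoss c + (budget + b).*2 <= B)%N.
    by exists (ntoss c + (budget + b).*2)%N => //; nia.
  apply: sub_all (duel_invP y h (eqP sz) pk ntB) => -[w [c' [[r [k|]]|]]] //=.
  rewrite /duel_inv /stream_inv /= => /and4P[-> -> /eqP -> le'].
  rewrite leqnn /=; nia.
- move=> /eqP nt _; rewrite /= andbT /stream_inv /= nt.
  move: sz; rewrite /nilp => /eqP/size0nil -> /=.
  by rewrite (eqP pk) leqnn /=; nia.
- by move=> le_r le_t; rewrite /= andbT /stream_inv /= sz pk (ltnW le_r); lia.
- by move=> nt le_r; rewrite /= andbT /stream_inv /= sz pk nt (ltnW le_r).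
Qed.

Lemma king_step_inv (y : C) (t : nat) (st : state) (c : config C) :
  stream_inv t (c, st) ->
  always (exec bias (king_step st) (Some y) c) (stream_inv t.+1).
Proof.
case: st => [rk|]; first exact: visit_inv.
case/and4P => /= sz pk nt t0.
apply: (@always_dbind _ _ _ _ _ predT); first exact: alwaysT.
move=> r _; apply: (@visit_inv y t (val r, None) c).
by rewrite /stream_inv /= sz pk nt -ltnS ltn_ord.
Qed.

Lemma exec_stream_inv (s : seq C) (t : nat) (c : config C) (st : state) :
  stream_inv t (c, st) ->
  always (@exec_stream R C bias king_algorithm s c st) (stream_inv (t + size s)).
Proof.
elim: s t c st => [|y s IH] t c st.
  by rewrite always_dret addn0.
move=> inv; apply: always_dbind (king_step_inv y inv) _.
by rewrite addnS -addSn => -[c' st'] /IH.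
Qed.

Lemma run_resources (s : seq C) :
  always (run bias king_algorithm s) (fun o =>
    (m.+1 * tosses_used o <= b.*2 * size s)%N && (memory_used o <= 1)%N).
Proof.
apply: (@always_dbind _ _ _ _ _ (stream_inv (size s))).
  exact: (@exec_stream_inv s 0).
move=> [c st] inv; rewrite /= andbT.
case: st inv => [[r [k|]]|] /and4P[/= _ pk].
(* The surplus [b.*2 * m.+1], present since the first stored coin enters without a duel, absorbs
   [r <= m]. *)
- by rewrite pk andbT; nia.
- by move=> /eqP -> _; rewrite (eqP pk) muln0.
- by move=> /eqP -> _; rewrite (eqP pk) muln0.
Qed.

End Resources.
End Algorithm.

(** * Success probability, by backward induction on the stream *)

Section Success.
Variables (R : realType) (C : eqType) (bias : C -> R) (m h b : nat).
Variables (D eta : R) (a : C).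
Hypothesis bias01 : forall x, 0 <= bias x <= 1.
Hypothesis D_gt0 : 0 < D.
Hypothesis best : forall x, x != a -> bias x + D <= bias a.
Hypothesis h_large : expR (- (D / 4 * h%:R)) <= eta.
Hypothesis b_large : expR (D / 4 * h%:R - D ^+ 2 / 8 * b%:R) <= eta.
Hypothesis eta_le1 : eta <= 1.

Let eta_ge0 : 0 <= eta := le_trans (expR_ge0 _) h_large.

Lemma Ex_exec_ge0 (A : Type) (pr : prog A) (cur : option C) (c : config C)
    (f : config C * A -> R) :
  (forall x, 0 <= f x) -> 0 <= Ex (exec bias pr cur c) f.
Proof.
move=> f0; elim: pr c => [x|hd k IH|k pr IH|pr IH|i pr IH] c /=; try exact: IH.
- by rewrite Ex_dret.
- rewrite Ex_dbind; case: fetch => [x|] /=; last by rewrite Ex_dret.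
  have /andP[x0 x1] := bias01 x.
  by rewrite Ex_dbern addr_ge0 // mulr_ge0 // subr_ge0.
- by rewrite Ex_dbind Ex_dunif mulr_ge0 ?invr_ge0 // sumr_ge0.
Qed.

Definition success (s : seq C) (c : config C) (st : state) : R :=
  Ex (@exec_stream R C bias (king_algorithm m h b) s c st)
     (fun cx => (onth (Defs.mem cx.1) 0 == Some a)%:R).

Lemma success_nil (c : config C) (st : state) :
  success [::] c st = (onth (Defs.mem c) 0 == Some a)%:R.
Proof. exact: Ex_dret. Qed.

Lemma success_cons (y : C) (s : seq C) (c : config C) (st : state) :
  success (y :: s) c st = Ex (exec bias (king_step m h b st) (Some y) c)
                             (fun cx => success s cx.1 cx.2).
Proof. exact: Ex_dbind. Qed.

Lemma success_ge0 (s : seq C) (c : config C) (st : state) : 0 <= success s c st.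
Proof.
elim: s c st => [|y s IH] c st; first by rewrite success_nil.
by rewrite success_cons Ex_exec_ge0.
Qed.

Lemma Ex_duel_step (x y : C) (budget d : nat) (c : config C)
    (f : config C * state -> R) :
  Defs.mem c = [:: x] ->
  let G e := Ex (exec bias (duel m budget e) (Some y) (tossed (tossed c))) f in
  Ex (exec bias (duel m budget.+1 d.+1) (Some y) c) f =
  bias x * (bias y * G d.+1 + (1 - bias y) * G d)
  + (1 - bias x) * (bias y * G d.+2 + (1 - bias y) * G d.+1).
Proof. by move=> cx G; rewrite /= cx /= !(Ex_dbind, Ex_dbern). Qed.

Lemma Ex_duel_stop (x y : C) (d : nat) (c : config C)
    (f : config C * state -> R) :
  Defs.mem c = [:: x] ->
  exists2 c', Defs.mem c' = [:: y] &
    Ex (exec bias (duel m 0 d.+1) (Some y) c) f = f (c', Some (m, Some 0%N)).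
Proof. by move=> cx; rewrite /= Ex_dret; eexists; last by []; rewrite /= cx. Qed.

(** Serves the duels before [a] arrives, whose winner is irrelevant. *)
Lemma Ex_duel_ge (x y : C) (w : R) (budget d : nat) (c : config C)
    (f : config C * state -> R) :
  Defs.mem c = [:: x] ->
  (forall c' k, Defs.mem c' = [:: x] \/ Defs.mem c' = [:: y] ->
     w <= f (c', Some (m, Some k))) ->
  w <= Ex (exec bias (duel m budget d) (Some y) c) f.
Proof.
move=> cx fw; elim: budget d c cx => [|k IH] [|d] c cx.
- by rewrite Ex_dret; apply: fw; left.
- by have [c' c'y ->] := Ex_duel_stop y d f cx; apply: fw; right.
- by rewrite Ex_dret; apply: fw; left.
rewrite (Ex_duel_step _ _ _ _ cx) /=.
have := IH d (tossed (tossed c)) cx; have := IH d.+1 (tossed (tossed c)) cx.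
have := IH d.+2 (tossed (tossed c)) cx.
move: (Ex _ _) (Ex _ _) (Ex _ _) => g0 g1 g2 w2 w1 w0.
have /andP[x0 x1] := bias01 x; have /andP[y0 y1] := bias01 y.
have wy i j : w <= i -> w <= j -> w <= bias y * i + (1 - bias y) * j.
  by move: y0 y1; nra.
by move: (wy _ _ w1 w0) (wy _ _ w2 w1) x0 x1; nra.
Qed.

(** The supermartingale step shared by both kinds of duel: [A] bounds the failure probability after
    a tied round, and a decided round multiplies it by [exp (- theta)] or [exp theta]. *)
Lemma round_bound (u v w A g good bad : R) :
  0 <= u <= 1 -> 0 <= v <= 1 -> u + D <= v -> 0 <= A ->
  w - A <= g -> w - A * expR (- (D / 4)) <= good ->
  w - A * expR (D / 4) <= bad ->
  w - A * expR (- (D ^+ 2 / 8))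
    <= u * (v * g + (1 - v) * bad) + (1 - u) * (v * good + (1 - v) * g).
Proof.
move=> /andP[u0 u1] /andP[v0 v1] uv A0 gw goodw badw.
apply: (@le_trans _ _ (u * (v * (w - A) + (1 - v) * (w - A * expR (D / 4)))
  + (1 - u) * (v * (w - A * expR (- (D / 4))) + (1 - v) * (w - A)))).
  have -> : u * (v * (w - A) + (1 - v) * (w - A * expR (D / 4)))
    + (1 - u) * (v * (w - A * expR (- (D / 4))) + (1 - v) * (w - A))
   = w - A * (u * (v + (1 - v) * expR (D / 4))
              + (1 - u) * (v * expR (- (D / 4)) + (1 - v))) by ring.
  by rewrite lerD2l lerN2 ler_wpM2l // round_moment.
have v0' : 0 <= 1 - v by rewrite subr_ge0.
have u0' : 0 <= 1 - u by rewrite subr_ge0.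
by rewrite lerD // ler_wpM2l // lerD // ler_wpM2l.
Qed.

Lemma Ex_duel_king (y : C) (budget d : nat) (c : config C)
    (f : config C * state -> R) :
  y != a -> Defs.mem c = [:: a] -> (forall x, 0 <= f x) ->
  (forall c' k, Defs.mem c' = [:: a] ->
     1 - expR (- (D ^+ 2 / 8 * k%:R)) <= f (c', Some (m, Some k))) ->
  1 - expR (D / 4 * d%:R - D ^+ 2 / 8 * budget%:R)
    <= Ex (exec bias (duel m budget d) (Some y) c) f.
Proof.
move=> ya ca f0 fk; elim: budget d c ca => [|k IH] [|d] c ca.
- by rewrite Ex_dret mulr0 add0r; exact: fk.
(* With no budget left the exponent is nonnegative, so the claimed bound is at most 0 and losing the
   king costs nothing. *)
- apply: le_trans (Ex_exec_ge0 _ _ _ f0).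
  rewrite subr_le0 mulr0 subr0; apply: le_trans (expR_ge1Dx _).
  by rewrite lerDl mulr_ge0 // divr_ge0 // ltW.
- by rewrite Ex_dret mulr0 add0r; exact: fk.
rewrite (Ex_duel_step _ _ _ _ ca) /=.
have := IH d (tossed (tossed c)) ca; have := IH d.+1 (tossed (tossed c)) ca.
have := IH d.+2 (tossed (tossed c)) ca.
move: (Ex _ _) (Ex _ _) (Ex _ _) => g0 g1 g2 w2 w1 w0.
have := @round_bound (bias y) (bias a) 1
  (expR (D / 4 * d.+1%:R - D ^+ 2 / 8 * k%:R)) g1 g0 g2
  (bias01 y) (bias01 a) (best ya) (expR_ge0 _) w1.
rewrite -!expRD.
have -> : D / 4 * d.+1%:R - D ^+ 2 / 8 * k%:R - D / 4
    = D / 4 * d%:R - D ^+ 2 / 8 * k%:R by rewrite -natr1; ring.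
have -> : D / 4 * d.+1%:R - D ^+ 2 / 8 * k%:R + D / 4
    = D / 4 * d.+2%:R - D ^+ 2 / 8 * k%:R by rewrite -!natr1; ring.
have -> : D / 4 * d.+1%:R - D ^+ 2 / 8 * k%:R - D ^+ 2 / 8
    = D / 4 * d.+1%:R - D ^+ 2 / 8 * k.+1%:R by rewrite -!natr1; ring.
by move=> /(_ w0 w2); lra.
Qed.

Lemma Ex_duel_challenger (x : C) (budget d : nat) (c : config C)
    (f : config C * state -> R) :
  x != a -> Defs.mem c = [:: x] -> (forall z, 0 <= f z) ->
  (forall c', Defs.mem c' = [:: a] -> 1 - eta <= f (c', Some (m, Some 0%N))) ->
  1 - eta - expR (- (D / 4 * d%:R))
    <= Ex (exec bias (duel m budget d) (Some a) c) f.
Proof.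
move=> xa cx f0 fa; elim: budget d c cx => [|k IH] [|d] c cx.
- by rewrite Ex_dret mulr0 oppr0 expR0 addrAC subrr sub0r (le_trans _ (f0 _)) ?oppr_le0.
- have [c' c'a ->] := Ex_duel_stop a d f cx; apply: le_trans (fa _ c'a).
  by rewrite gerBl expR_ge0.
- by rewrite Ex_dret mulr0 oppr0 expR0 addrAC subrr sub0r (le_trans _ (f0 _)) ?oppr_le0.
rewrite (Ex_duel_step _ _ _ _ cx) /=.
have := IH d (tossed (tossed c)) cx; have := IH d.+1 (tossed (tossed c)) cx.
have := IH d.+2 (tossed (tossed c)) cx.
move: (Ex _ _) (Ex _ _) (Ex _ _) => g0 g1 g2 w2 w1 w0.
have := @round_bound (bias x) (bias a) (1 - eta)
  (expR (- (D / 4 * d.+1%:R))) g1 g2 g0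
  (bias01 x) (bias01 a) (best xa) (expR_ge0 _) w1.
rewrite -!expRD.
have -> : - (D / 4 * d.+1%:R) - D / 4 = - (D / 4 * d.+2%:R).
  by rewrite -!natr1; ring.
have -> : - (D / 4 * d.+1%:R) + D / 4 = - (D / 4 * d%:R).
  by rewrite -natr1; ring.
move=> /(_ w2 w0); apply: le_trans.
(* This potential ignores the budget, so the gain [exp (- D ^ 2 / 8)] is simply dropped. *)
rewrite lerD2l lerN2 ler_expR gerDl oppr_le0.
by rewrite divr_ge0 // sqr_ge0.
Qed.

Lemma success_king (s : seq C) (c : config C) (r k : nat) :
  a \notin s -> Defs.mem c = [:: a] ->
  1 - expR (D / 4 * h%:R - D ^+ 2 / 8 * (k + b)%:R)
    <= success s c (Some (r, Some k)).
Proof.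
elim: s c r k => [|y s IH] c r k.
  by rewrite success_nil => _ -> /=; rewrite eqxx gerBl expR_ge0.
rewrite inE negb_or => /andP[ay as_] ca; rewrite success_cons.
case: r => [|r]; last by rewrite Ex_dret; apply: IH.
apply: Ex_duel_king => //; first by rewrite eq_sym.
  by move=> z; exact: success_ge0.
move=> c' k' c'a; apply: le_trans (IH _ _ _ as_ c'a).
(* The next challenge contributes the factor [exp (theta h - lambda b) <= 1]: its income pays for
   its lead, so the bound does not degrade with the length of [s]. *)
rewrite lerD2l lerN2 natrD mulrDr opprD addrCA expRD.
by rewrite ler_piMr ?expR_ge0 // (le_trans b_large).
Qed.

Lemma success_new_king (s : seq C) (c : config C) (r : nat) :
  a \notin s -> Defs.mem c = [:: a] -> 1 - eta <= success s c (Some (r, Some 0%N)).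
Proof.
move=> as_ ca; apply: le_trans (success_king r 0 as_ ca).
by rewrite lerD2l lerN2 add0n.
Qed.

(** The index condition makes [a] arrive at a challenge time. One [eta] pays for failing to unseat
    the king, the other for being replaced later. *)
Lemma success_selected (s : seq C) (c : config C) (r q : nat) (k : option nat) :
  uniq s -> a \in s -> index a s = (r + q * m.+1)%N ->
  (if k is Some _ then exists2 x, x != a & Defs.mem c = [:: x]
   else Defs.mem c = [::]) ->
  1 - eta *+ 2 <= success s c (Some (r, k)).
Proof.
elim: s c r q k => // y s IH c r q k /= /andP[ys us].
rewrite inE success_cons eq_sym; have [ya _|ya /= as_] := eqVneq a y.
  rewrite -{}ya in ys *; case: r => [|//] _; case: k => [k|] /=.
    move=> [x xa cx].
    apply: le_trans (Ex_duel_challenger _ _ xa cx (fun _ => success_ge0 _ _ _) _).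
      by rewrite mulr2n opprD addrA lerD2l lerN2.
    by move=> c' c'a; exact: success_new_king.
  move=> c0; rewrite Ex_dret; apply: le_trans (success_new_king _ ys _).
    by rewrite lerD2l lerN2 mulr2n lerDl.
  by rewrite /= c0.
case: r => [|r] idx; last first.
  by rewrite Ex_dret => ck; apply: (IH c r q) => //; lia.
case: q idx => [//|q]; rewrite add0n mulSn => idx.
have {}idx : index a s = (m + q * m.+1)%N by lia.
case: k => [k [x xa cx]|c0] /=.
  apply: Ex_duel_ge cx _ => c' k' c'xy; apply: IH idx _ => //.
  by case: c'xy => ->; [exists x | exists y; rewrite // eq_sym].
by rewrite Ex_dret; apply: IH idx _ => //=; exists y; rewrite 1?eq_sym // c0.
Qed.

Lemma run_success (s : seq C) :
  uniq s -> a \in s ->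
  m.+1%:R^-1 * (1 - eta *+ 2)
    <= Pr (run bias (king_algorithm m h b) s) (fun o => output o == Some a).
Proof.
move=> us as_; rewrite Pr_Ex Ex_dbind.
set c0 := Config _ _ _.
apply: (@le_trans _ _ (success s c0 None)); last first.
  by rewrite le_eqVlt; apply/orP; left; apply/eqP/eq_Ex => cx; rewrite !Ex_dbind !Ex_dret.
(* Only the draw equal to this residue selects [a]; the other draws are bounded below by 0. *)
have rlt : (index a s %% m.+1 < m.+1)%N by rewrite ltn_mod.
have := @success_selected s c0 (index a s %% m.+1) (index a s %/ m.+1) None us as_.
rewrite addnC -divn_eq => /(_ erefl erefl).
case: s us as_ @c0 rlt => // y s us as_ c0 rlt; rewrite !success_cons.
rewrite Ex_dbind Ex_dunif => le_s; rewrite ler_wpM2l ?invr_ge0 //.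
rewrite (bigD1 (Ordinal rlt)) //= ler_wpDr //.
by apply: sumr_ge0 => i _; apply: Ex_exec_ge0 => z; exact: success_ge0.
Qed.

End Success.

(** * Choice of the parameters *)

Section Tuning.
Variable R : realType.

Lemma trunc_ub (x : R) : 0 <= x -> x <= (Num.trunc x).+1%:R <= x + 1.
Proof.
by move=> /truncn_itv/andP[lex ltx]; rewrite (ltW ltx) -natr1 lerD2r.
Qed.

Lemma ln_inv_ge (x : R) : 0 < x -> 1 - x <= ln (1 / x).
Proof.
move=> x0; rewrite div1r lnV ?posrE //.
have := @le_ln1Dx R (x - 1); rewrite addrCA subrr addr0 => le_ln.
by rewrite lerNr opprB le_ln // ltrBrDl subrr.
Qed.

Definition confidence (delta : R) : R := if delta <= 1/2 then delta else 1/2.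

(* For [delta > 1/2] even one challenge per coin can exceed the toss budget, so
   only one coin in [period delta + 1], about [1 / (2 (1 - delta))], is used. *)
Definition period (delta : R) : nat :=
  if delta <= 1/2 then 0 else (Num.trunc (1 / (2 * (1 - delta)))).-1.

(** With [eta = x / 2], the requirements are [theta h >= ln (2 / x)] and
    [lambda b >= theta h + ln (2 / x)]; [lead] and [income] solve them up to rounding. *)
Definition lead (D x : R) : nat := (Num.trunc (ln (2 / x) / (D / 4))).+1.

Definition income (D x : R) : nat :=
  (Num.trunc ((D / 4 * (lead D x)%:R + ln (2 / x)) / (D ^+ 2 / 8))).+1.

Lemma confidence_itv (delta : R) : 0 < delta -> 0 < confidence delta <= 1/2.
Proof. by rewrite /confidence; case: ifP => [-> ->//|_ _]; lra. Qed.

(** The lower bound lets rounding errors be absorbed into the logarithm; the upper one is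
    [2 / x <= 1 / x ^ 2]. *)
Lemma ln_two_div_itv (x : R) : 0 < x <= 1/2 ->
  1/2 <= ln (2 / x) <= 2 * ln (1 / x).
Proof.
move=> /andP[x0 x1].
have l1 := ln_inv_ge x0.
have i0 : 0 < 1 / x by rewrite divr_gt0.
have i2 : 0 < 2 / x by rewrite divr_gt0.
apply/andP; split.
  have : ln (1 / x) <= ln (2 / x).
    by rewrite ler_ln ?posrE // ler_pM2r ?invr_gt0 //; lra.
  by lra.
have -> : 2 * ln (1 / x) = ln (1 / x * (1 / x)) by rewrite [RHS]lnM ?posrE //; ring.
rewrite ler_ln ?posrE //; last exact: mulr_gt0.
rewrite mulrA ler_pM2r ?invr_gt0 // mulr1 ler_pdivlMr //; lra.
Qed.

Lemma expR_ln_two_div (x : R) : 0 < x -> expR (- ln (2 / x)) = x / 2.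
Proof.
by move=> x0; rewrite expRN lnK ?posrE ?divr_gt0 // invf_div.
Qed.

Lemma parameters (D x : R) : 0 < D <= 1 -> 0 < x <= 1/2 ->
  [/\ expR (- (D / 4 * (lead D x)%:R)) <= x / 2,
      expR (D / 4 * (lead D x)%:R - D ^+ 2 / 8 * (income D x)%:R) <= x / 2
    & (income D x)%:R * D ^+ 2 <= 52 * ln (1 / x)].
Proof.
move=> /andP[D0 D1] x01; have /andP[x0 _] := x01.
have /andP[L0 L1] := ln_two_div_itv x01.
have T0 : 0 < D / 4 by rewrite divr_gt0.
have V0 : 0 < D ^+ 2 / 8 by rewrite divr_gt0 // exprn_gt0.
have /andP[] : ln (2 / x) / (D / 4) <= (lead D x)%:R <= ln (2 / x) / (D / 4) + 1.
  by apply: trunc_ub; rewrite divr_ge0 // ?(ltW T0) //; lra.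
rewrite ler_pdivrMr // -lerBlDr ler_pdivlMr // => h1 h2.
have N0 : 0 <= D / 4 * (lead D x)%:R by rewrite mulr_ge0 // ltW.
have /andP[] : (D / 4 * (lead D x)%:R + ln (2 / x)) / (D ^+ 2 / 8)
    <= (income D x)%:R
    <= (D / 4 * (lead D x)%:R + ln (2 / x)) / (D ^+ 2 / 8) + 1.
  by apply: trunc_ub; rewrite divr_ge0 // ?(ltW V0) //; lra.
rewrite ler_pdivrMr // -lerBlDr ler_pdivlMr // => b1 b2.
have DD : D ^+ 2 <= 1 by rewrite expr_le1 // ltW.
(* With [L = ln (2 / x)], the income times [D ^ 2] is at most [16 L + 2 D + D ^ 2 <= 22 L <= 44 ln
   (1 / x)], within the constant 52. *)
split; last by lra.
- by rewrite -expR_ln_two_div // ler_expR; lra.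
- by rewrite -expR_ln_two_div // ler_expR; lra.
Qed.

(** For [delta > 1/2], let [M] be the integer part of [z = 1 / (2 (1 - delta))]. Then [M <= z] gives
    the first claim, and [z < M + 1 <= 2 M] gives [4 M (1 - delta) >= 1 >= ln 2], hence the
    second. *)
Lemma period_bound (delta : R) : 0 < delta -> delta < 1 ->
  1 - delta <= (period delta).+1%:R^-1 * (1 - confidence delta) /\
  ln (1 / confidence delta) <= 4 * (period delta).+1%:R * ln (1 / delta).
Proof.
move=> d0 d1; rewrite /period /confidence; case: ifPn => [le_d|].
  have l0 := ln_inv_ge d0.
  by rewrite invr1 mul1r; split => //; lra.
rewrite -ltNge => d2; set z := 1 / _.
have e0 : 0 < 2 * (1 - delta) by rewrite mulr_gt0 // subr_gt0.
have z1 : 1 <= z by rewrite ler_pdivlMr //; lra.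
have /truncn_itv : 0 <= z by exact: le_trans z1.
(* Since [z >= 1], the truncation is positive and the predecessor in [period] loses nothing. *)
case: Num.trunc => [|t]; first by move=> /andP[_]; lra.
rewrite -pred_Sn => /andP[t1 t2].
have t0 : 0 < t.+1%:R :> R by rewrite ltr0n.
have l0 := ln_inv_ge d0.
have ln2 : ln (1 / (1 / 2)) <= 1 :> R.
  have := @le_ln1Dx R 1.
  have -> : 1 / (1 / 2) = 1 + 1 :> R by field.
  by apply; lra.
split.
  rewrite mulrC ler_pdivlMr //.
  by move: t1; rewrite /z ler_pdivlMr //; lra.
have : 1 <= 4 * t.+1%:R * (1 - delta).
  move: t2; rewrite /z ltr_pdivrMr // -natr1.
  have : 1 <= t.+1%:R :> R by rewrite ler1n.
  move: (t.+1%:R) t0 => w; nra.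
have : 4 * t.+1%:R * (1 - delta) <= 4 * t.+1%:R * ln (1 / delta).
  by rewrite ler_wpM2l // mulr_ge0 // ltW.
by lra.
Qed.

End Tuning.

(** Indices are sorted instead of biases: [a] and [a'] are the first two. The second coin [a']
    serves to derive that the gap is at most 1. *)
Lemma gap_attained (R : realType) (n : nat) (p : 'I_n -> R) : (2 <= n)%N ->
  exists a a' : 'I_n, a' != a /\ forall j, j != a -> p j + gap p <= p a.
Proof.
move=> n2; rewrite /gap sort_map.
set t := sort _ _.
have tperm : perm_eq t (enum 'I_n) by rewrite perm_sort.
have : size t = n by rewrite (perm_size tperm) size_enum_ord.
have : uniq t by rewrite (perm_uniq tperm) enum_uniq.
have tsort : sorted (relpre p >=%R) t.
  by apply: sort_sorted => i j; exact: le_total.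
have tin j : j \in t by rewrite (perm_mem tperm) mem_enum.
case: t tsort tin {tperm} => [|a [|a' t]] /=; try by move=> *; lia.
move=> /andP[_ path_t] tin /andP[a_notin _] _; exists a, a'; split.
  by apply: contraNneq a_notin => ->; rewrite mem_head.
move=> j ja; rewrite addrCA gerDl subr_le0.
have := tin j; rewrite !inE (negbTE ja) /= => /predU1P[->//|jt].
have := @order_path_min _ (relpre p >=%R) a' t.
by move=> /(_ _ path_t)/allP/(_ _ jt); apply=> x y z /= xy yz; exact: le_trans xy.
Qed.

Theorem theorem1 (R : realType) :
  exists (alg : R -> R -> algorithm) (K : R),
    0 < K /\
    forall (n : nat) (p : 'I_n -> R) (Delta delta : R) (stream : seq 'I_n),
      (2 <= n)%N ->
      (forall i : 'I_n, 0 <= p i <= 1) ->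
      Delta = gap p -> 0 < Delta ->
      0 < delta -> delta < 1 ->
      perm_eq stream (enum 'I_n) ->
      let law := run p (alg Delta delta) stream in
      [/\ 1 - delta <= Pr law (finds_most_biased p),
          always law (fun o =>
             (tosses_used o)%:R <= K * (n%:R / Delta ^+ 2 * ln (1 / delta)))
        & always law (fun o => (memory_used o <= 1)%N)].
Proof.
(* [416 = 2 * 52 * 4]: two tosses per round, 52 from [parameters], 4 from [period_bound]. *)
exists (fun D d => king_algorithm (period d) (lead D (confidence d))
                                  (income D (confidence d))), 416.
split=> // n p D d s n2 p01 Dgap D0 d0 d1 sperm law.
have [a [a' [a'a best]]] := gap_attained p n2; rewrite -Dgap in best.
have D1 : D <= 1.
  by have := best _ a'a; have /andP[? _] := p01 a'; have /andP[_ ?] := p01 a; lra.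
have c01 := confidence_itv d0.
have [|hl bl il] := @parameters R D (confidence d) _ c01; first by rewrite D0.
have [succ_ge ln_le] := period_bound d0 d1.
have res := run_resources (period d) (lead D (confidence d))
  (income D (confidence d)) p s.
have size_s : size s = n by rewrite (perm_size sperm) size_enum_ord.
split.
- apply: le_trans succ_ge _.
  have eta1 : confidence d / 2 <= 1 by case/andP: c01; lra.
  have us : uniq s by rewrite (perm_uniq sperm) enum_uniq.
  have as_ : a \in s by rewrite (perm_mem sperm) mem_enum.
  have := @run_success _ _ p (period d) _ _ D _ a p01 D0 best hl bl eta1 s us as_.
  have -> : confidence d / 2 *+ 2 = confidence d by rewrite mulr2n; field.
  (* The positive gap makes [a] the unique most biased coin, so the two events coincide. *)
  congr (_ <= _); rewrite !Pr_Ex; apply: eq_Ex => o; congr (_%:R).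
  rewrite /finds_most_biased; case: output => // i; congr nat_of_bool.
  rewrite (inj_eq Some_inj) /most_biased.
  have [->|ia] := eqVneq i a.
    apply/esym/forallP => j; have [->//|ja] := eqVneq j a.
    by have := best _ ja; lra.
  by apply/esym/negbTE/forallPn; exists a; rewrite -ltNge; have := best _ ia; lra.
- apply: sub_all res => -[w o] /= /andP[+ _]; rewrite size_s.
  rewrite -(ler_nat R) !natrM -muln2 natrM.
  set T := (tosses_used o)%:R; set M := (period d).+1%:R => le_T.
  have M0 : 0 < M by rewrite ltr0n.
  have DD0 : 0 < D ^+ 2 by rewrite exprn_gt0.
  rewrite -(ler_pM2l M0) -(ler_pM2r DD0).
  have -> : M * (416 * (n%:R / D ^+ 2 * ln (1 / d))) * D ^+ 2
      = 104 * (4 * M * ln (1 / d)) * n%:R by field; rewrite gt_eqF.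
  apply: le_trans (ler_wpM2r (ltW DD0) le_T) _.
  set I := (income _ _)%:R in il *.
  have -> : I * 2 * n%:R * D ^+ 2 = 2 * (I * D ^+ 2) * n%:R by ring.
  rewrite ler_wpM2r //; lra.
- by apply: sub_all res => -[w o] /= /andP[].
Qed.
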